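(* Let $(X,\|\cdot\|_X)$ and $(Y,\|\cdot\|_Y)$ be rearrangement invariant Banach spaces of random variables over the probability space $(\Omega,\mathcal{B},\mathbf{P})$ such that $(X,Y)$ is a weak pair, $(X,Y)\in V\Phi_2$, with constant $U(X,Y)$. Let $\xi_1,\xi_2,\ldots$ be a sequence of independent, centered, non-zero random variables belonging to $X$, with variances $\sigma_i^2=\mathrm{Var}(\xi_i)\in(0,\infty)$, and suppose that $$\kappa := \sup_i \frac{\|\xi_i\|_X}{\sigma_i}<\infty .$$ Put $$S_n=\frac{\sum_{i=1}^n\xi_i}{\sqrt{\sum_{i=1}^n\sigma_i^2}},\qquad n=1,2,\ldots .$$ Then $$\sup_n\|S_n\|_Y\le \kappa\cdot U(X,Y),$$ and $$\sup_n T_{S_n}(t)\le T^Y\!\left(\frac{t}{\kappa\cdot U(X,Y)}\right),\qquad t\ge 0 .$$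
   Context: $(\Omega,\mathcal{B},\mathbf{P})$ is a non-trivial probability space with expectation $\mathbf{E}$; random variables are numerical valued, and centered means $\mathbf{E}\xi=0$. Spaces: $X$ and $Y$ are rearrangement invariant Banach function spaces consisting of numerical valued random variables on $\Omega$ with finite norm. Weak pair: $(X,Y)\in V\Phi_2$ means that there exists a finite constant $U=U(X,Y)$ such that for every sequence $\eta_1,\eta_2,\ldots$ of mutually independent centered random variables belonging to $X$, $$\Big\|\sum_{k=1}^n\eta_k\Big\|_Y\le U(X,Y)\sqrt{\sum_{k=1}^n\|\eta_k\|_X^2},\qquad n=2,3,4,\ldots .$$ Tail function: $T_\tau(t)=\mathbf{P}(|\tau|\ge t)$, $t\ge0$, for a random variable $\tau$. Tail characteristic of a space $Y$: $T^Y(t)=\sup\{T_\tau(t):\ \tau\in Y,\ \|\tau\|_Y\le 1\}$, $t\ge 0$. *)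

(* Defs.v *)
From HB Require Import structures.
From mathcomp Require Import all_boot all_order all_algebra.
From mathcomp Require Import all_classical all_reals all_analysis.
From mathcomp Require Import measurable_realfun.
Set Implicit Arguments.
Unset Strict Implicit.
Unset Printing Implicit Defensive.
Import Order.TTheory GRing.Theory Num.Theory.
Import numFieldNormedType.Exports.
Local Open Scope classical_set_scope.
Local Open Scope ring_scope.
Local Open Scope ereal_scope.

Definition nontrivial_probability d (T : measurableType d) (R : realType)
    (P : probability T R) : Prop :=
  exists A : set T, [/\ measurable A, 0 < P A & P A < 1].

Definition tail d (T : measurableType d) (R : realType) (P : probability T R)
    (tau : {RV P >-> R}) (t : R) : \bar R :=
  P [set w | (t <= `|tau w|)%R].

(* A rearrangement invariant (symmetric) Banach function space, in the sense of
   Krein, Petunin and Semenov, is encoded by its norm extended by +oo to all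
   random variables; the space is the set where the norm is finite. Random
   variables are not quotiented by almost sure equality: [ri_ideal] makes the
   norm depend only on the almost sure class. The further axioms of Bennett and
   Sharpley (Fatou property, bounded functions in X, X embedded in L^1) are not
   required, and the spaces satisfying them are instances of this record. *)
Record ri_space d (T : measurableType d) (R : realType)
    (P : probability T R) := RISpace {
  ri_norm :> {RV P >-> R} -> \bar R;
  ri_ge0 : forall f, 0 <= ri_norm f;
  ri_eq0 : forall f, ri_norm f = 0 -> {ae P, forall w, f w = 0%R};
  ri_scale : forall (c : R) f, ri_norm (scale_mfun c f) = `|c|%:E * ri_norm f;
  ri_triangle : forall f g : {RV P >-> R},
    ri_norm (f + g)%R <= ri_norm f + ri_norm g;
  ri_complete : forall f : nat -> {RV P >-> R},
    (forall n, ri_norm (f n) < +oo) ->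
    (forall e : R, (0 < e)%R -> exists N : nat, forall m n : nat,
      (N <= m)%N -> (N <= n)%N -> ri_norm (f m - f n)%R < e%:E) ->
    exists2 g : {RV P >-> R}, ri_norm g < +oo &
      (fun n => ri_norm (f n - g)%R) @ \oo --> 0;
  ri_ideal : forall f g : {RV P >-> R},
    {ae P, forall w, (`|f w| <= `|g w|)%R} -> ri_norm f <= ri_norm g;
  ri_rearrangement : forall f g : {RV P >-> R},
    (forall t : R, (0 <= t)%R -> tail f t = tail g t) -> ri_norm f = ri_norm g
}.

Definition in_space d (T : measurableType d) (R : realType)
    (P : probability T R) (X : ri_space P) (f : {RV P >-> R}) : Prop :=
  X f < +oo.

Definition mutually_independent d (T : measurableType d) (R : realType)
    (P : probability T R) (xi : nat -> {RV P >-> R}) : Prop :=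
  forall (J : seq nat) (B : nat -> set R), uniq J ->
    (forall i, i \in J -> measurable (B i)) ->
    P (\bigcap_(i in [set` J]) (xi i @^-1` B i)) =
      \prod_(i <- J) P (xi i @^-1` B i).

(* Integrability is required because the library's expectation is a total
   function, with a conventional value on non-integrable variables. *)
Definition centered d (T : measurableType d) (R : realType)
    (P : probability T R) (f : {RV P >-> R}) : Prop :=
  P.-integrable setT (EFin \o f) /\ 'E_P[f] = 0.

(* (X, Y) belongs to V Phi_2 with constant U. *)
Definition weak_pair_with d (T : measurableType d) (R : realType)
    (P : probability T R) (X Y : ri_space P) (U : R) : Prop :=
  forall eta : nat -> {RV P >-> R},
    mutually_independent eta ->
    (forall k, centered (eta k)) ->
    (forall k, in_space X (eta k)) ->
    forall n : nat, (2 <= n)%N ->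
      Y (\sum_(k < n) eta k)%R <=
        (U * Num.sqrt (\sum_(k < n) fine (X (eta k)) ^+ 2))%:E.

Definition tail_char d (T : measurableType d) (R : realType)
    (P : probability T R) (Y : ri_space P) (t : R) : \bar R :=
  ereal_sup [set tail tau t | tau in [set tau : {RV P >-> R} | Y tau <= 1]].

Definition stddev d (T : measurableType d) (R : realType)
    (P : probability T R) (f : {RV P >-> R}) : R :=
  Num.sqrt (fine 'V_P[f]).

Definition kappa d (T : measurableType d) (R : realType)
    (P : probability T R) (X : ri_space P) (xi : nat -> {RV P >-> R}) : \bar R :=
  ereal_sup (range (fun i => X (xi i) * ((stddev (xi i))^-1)%:E)).

(* The sequence is indexed from 0, so the sum of its first n terms ranges over
   the indices i < n. *)
Definition normed_sum d (T : measurableType d) (R : realType)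
    (P : probability T R) (xi : nat -> {RV P >-> R}) (n : nat) : {RV P >-> R} :=
  scale_mfun (Num.sqrt (\sum_(i < n) stddev (xi i) ^+ 2))^-1%R
             (\sum_(i < n) xi i)%R.

(* Main.v *)
Require Import Defs.
From mathcomp Require Import all_boot all_order all_algebra.
From mathcomp Require Import all_classical all_reals all_analysis.
From mathcomp Require Import measurable_realfun.
Import Order.TTheory GRing.Theory Num.Theory.
Import numFieldNormedType.Exports.
Local Open Scope classical_set_scope.
Local Open Scope ring_scope.
Local Open Scope ereal_scope.

(** The first bound is the weak pair inequality combined with homogeneity.
    Since [X (xi i) <= kappa * sigma_i], the inequality gives
    [Y (\sum_i xi i) <= U * sqrt (\sum_i (kappa * sigma_i)^2)
                      = kappa * U * sqrt (\sum_i sigma_i^2)],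
    and dividing by the square root leaves [kappa * U].

    The inequality defining a weak pair is only assumed for sums of at least two
    terms. A single variable is covered by padding: multiplying the members of
    an independent centered sequence by constants preserves independence,
    centering and membership in [X], so the sequence can be cut off by zeros
    after its first terms and one zero term added to the sum. This is
    [weak_pair_sum_le].

    The tail bound follows because [f / a] is in the unit ball of [Y] as soon as
    [Y f <= a] with [a > 0], and the tail of [f] at [t] is the tail of [f / a] at
    [t / a] ([tail_le_tail_char]). It is applied with [a = kappa * U], whose two
    factors are positive because the variables are nonzero: [kappa] dominates
    [X (xi 0) / sigma_0], while [0 < Y (xi 0) <= U * X (xi 0)] forces [U > 0]. *)

Set Implicit Arguments.
Unset Strict Implicit.

(** The event that a multiple of [xi i] lies in [B i] is the event that [xi i]
    lies in a preimage of [B i]. The constants [c i] may vanish, which is what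
    allows a sequence to be cut off by zeros. *)
Lemma mutually_independent_scale (d : measure_display) (T : measurableType d)
    (R : realType) (P : probability T R) (xi : nat -> {RV P >-> R})
    (c : nat -> R) :
  mutually_independent xi ->
  mutually_independent (fun i => scale_mfun (c i) (xi i) : {RV P >-> R}).
Proof.
move=> ind J B uJ mB.
apply: (ind J (fun i => (fun x : R => x * c i)%R @^-1` B i)) => // i iJ.
have mc : measurable_fun setT (fun x : R => x * c i)%R.
  exact: mulrr_measurable.
rewrite -[X in measurable X]setTI; apply: mc => //; exact: mB.
Qed.

Lemma centered_scale (d : measure_display) (T : measurableType d)
    (R : realType) (P : probability T R) (c : R) (f : {RV P >-> R}) :
  centered f -> centered (scale_mfun c f : {RV P >-> R}).
Proof.
move=> [intf Ef0]; split.
- rewrite (_ : EFin \o _ = fun w => c%:E * (f w)%:E).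
    exact: integrableZl.
  by apply/funext => w /=; rewrite mulrC EFinM.
- by rewrite expectationZl ?Ef0 ?mule0//; exact/Lfun1_integrable.
Qed.

(** The case [n = 1] is the gain over [weak_pair_with]: the variables of index
    at least [n] are replaced by zeros, and the inequality is read at [n + 1],
    where the extra term contributes nothing to either side. *)
Lemma weak_pair_sum_le (d : measure_display) (T : measurableType d)
    (R : realType) (P : probability T R) (X Y : ri_space P) (U : R)
    (eta : nat -> {RV P >-> R}) (n : nat) :
  weak_pair_with X Y U -> mutually_independent eta ->
  (forall k, centered (eta k)) -> (forall k, in_space X (eta k)) ->
  (0 < n)%N ->
  Y (\sum_(k < n) eta k)%R <=
    (U * Num.sqrt (\sum_(k < n) fine (X (eta k)) ^+ 2))%:E.
Proof.
move=> hXY ind cent inX n0.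
pose c k : R := (k < n)%N%:R.
pose zeta k : {RV P >-> R} := scale_mfun (c k) (eta k).
have Xzeta k : X (zeta k) = (c k)%:E * X (eta k).
  by rewrite ri_scale ger0_norm// ler0n.
have := hXY zeta (mutually_independent_scale c ind)
  (fun k => centered_scale (c k) (cent k)) _ n.+1.
rewrite !big_ord_recr /= Xzeta /c ltnn mul0e expr0n addr0.
have -> : (\sum_(k < n) zeta k + zeta n)%R = (\sum_(k < n) eta k)%R.
  have -> : zeta n = 0%R.
    by apply/mfuneqP => w; rewrite /zeta /= /c ltnn mulr0.
  rewrite addr0; apply: eq_bigr => k _; apply/mfuneqP => w.
  by rewrite /zeta /= /c ltn_ord mulr1.
under eq_bigr do rewrite Xzeta /c ltn_ord mul1e.
apply=> // k; rewrite /in_space Xzeta.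
by rewrite /c; case: (k < n)%N; rewrite ?mul1e ?mul0e//; exact: inX.
Qed.

Lemma ri_norm_gt0 (d : measure_display) (T : measurableType d)
    (R : realType) (P : probability T R) (X : ri_space P) (f : {RV P >-> R}) :
  ~ {ae P, forall w, f w = 0%R} -> 0 < X f.
Proof.
move=> nz; rewrite lt0e ri_ge0 andbT; apply/eqP => /ri_eq0; exact: nz.
Qed.

(** The inequality for a single variable reads [Y (eta 0) <= U * X (eta 0)],
    and its left side is positive when [eta 0] is not almost surely zero. *)
Lemma weak_pair_const_gt0 (d : measure_display) (T : measurableType d)
    (R : realType) (P : probability T R) (X Y : ri_space P) (U : R)
    (eta : nat -> {RV P >-> R}) :
  weak_pair_with X Y U -> mutually_independent eta ->
  (forall k, centered (eta k)) -> (forall k, in_space X (eta k)) ->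
  ~ {ae P, forall w, eta 0%N w = 0%R} -> (0 < U)%R.
Proof.
move=> hXY ind cent inX nz.
have := @weak_pair_sum_le _ _ _ _ _ _ _ _ 1%N hXY ind cent inX isT.
rewrite !big_ord1 => /(lt_le_trans (ri_norm_gt0 Y nz)).
rewrite lte_fin; apply: contraTT; rewrite -!leNgt => U0.
by rewrite mulr_le0_ge0// sqrtr_ge0.
Qed.

(** The witness in the supremum is [f / a], which lies in the unit ball. *)
Lemma tail_le_tail_char (d : measure_display) (T : measurableType d)
    (R : realType) (P : probability T R) (Y : ri_space P) (f : {RV P >-> R})
    (a t : R) :
  (0 < a)%R -> Y f <= a%:E -> tail f t <= tail_char Y (t / a).
Proof.
move=> a0 Yfa; apply: ereal_sup_ubound.
have ai0 : (0 < a^-1)%R by rewrite invr_gt0.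
exists (scale_mfun a^-1 f) => /=.
  by rewrite ri_scale gtr0_norm// muleC lee_pdivrMr// mul1e.
congr (P _); apply/seteqP; split=> w /=;
  by rewrite normrM (gtr0_norm ai0) ler_pM2r.
Qed.

Lemma ri_norm_le_kappa (d : measure_display) (T : measurableType d)
    (R : realType) (P : probability T R) (X : ri_space P)
    (xi : nat -> {RV P >-> R}) (i : nat) :
  (0 < stddev (xi i))%R -> X (xi i) <= kappa X xi * (stddev (xi i))%:E.
Proof.
move=> s0; rewrite -lee_pdivrMr//; apply: ereal_sup_ubound; by exists i.
Qed.

Unset Implicit Arguments.
Set Strict Implicit.

Theorem theorem2p1 (d : measure_display) (T : measurableType d) (R : realType)
    (P : probability T R) (hP : nontrivial_probability P)
    (X Y : ri_space P) (U : R) (hXY : weak_pair_with X Y U)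
    (xi : nat -> {RV P >-> R})
    (hindep : mutually_independent xi)
    (hcent : forall i, centered (xi i))
    (hnz : forall i, ~ {ae P, forall w, xi i w = 0%R})
    (hX : forall i, in_space X (xi i))
    (hvar : forall i, 0 < 'V_P[xi i] /\ 'V_P[xi i] < +oo)
    (hkappa : kappa X xi < +oo) :
  ereal_sup [set Y (normed_sum xi n) | n in [set n | (1 <= n)%N]]
    <= kappa X xi * U%:E
  /\
  (forall t : R, (0 <= t)%R ->
    ereal_sup [set tail (normed_sum xi n) t | n in [set n | (1 <= n)%N]]
      <= tail_char Y (t / (fine (kappa X xi) * U))).
Proof.
have U0 : (0 < U)%R := weak_pair_const_gt0 hXY hindep hcent hX (hnz 0%N).
have s0 i : (0 < stddev (xi i))%R.
  by have [? ?] := hvar i; rewrite sqrtr_gt0 fine_gt0//; apply/andP.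
have k0 : 0 < kappa X xi.
  have := lt_le_trans (ri_norm_gt0 X (hnz 0%N)) (ri_norm_le_kappa X (s0 0%N)).
  by rewrite pmule_lgt0// lte_fin.
have := fun i => ri_norm_le_kappa X (s0 i).
have kfin : kappa X xi \is a fin_num by rewrite ge0_fin_numE// ltW.
rewrite -(fineK kfin); set K := fine _ => Xle /=.
have K0 : (0 < K)%R by rewrite fine_gt0// k0.
have YS n : (0 < n)%N -> Y (normed_sum xi n) <= (K * U)%:E.
  move=> n0; rewrite ri_scale; set V := (\sum_(i < n) _)%R.
  have V0 : (0 < Num.sqrt V)%R.
    rewrite sqrtr_gt0 /V -(prednK n0) big_ord_recl ltr_pwDl ?exprn_gt0//.
    by apply: sumr_ge0 => i _; rewrite sqr_ge0.
  rewrite gtr0_norm ?invr_gt0// muleC lee_pdivrMr//.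
  apply: (le_trans (weak_pair_sum_le hXY hindep hcent hX n0)).
  rewrite -EFinM; have -> : (K * U * Num.sqrt V = U * Num.sqrt (K ^+ 2 * V))%R.
    by rewrite sqrtrM ?sqr_ge0// sqrtr_sqr gtr0_norm// mulrCA mulrA.
  rewrite lee_fin ler_pM2l// ler_wsqrtr//.
  rewrite /V mulr_sumr; apply: ler_sum => i _; rewrite -exprMn.
  rewrite ler_pXn2r ?nnegrE ?fine_ge0 ?ri_ge0 ?(ltW (mulr_gt0 _ _))//.
  rewrite -lee_fin fineK; first exact: Xle.
  by rewrite ge0_fin_numE ?ri_ge0//; exact: hX.
split; last move=> t _; apply: ge_ereal_sup => _ [n n0 <-].
- by rewrite -EFinM; exact: YS.
- by apply: tail_le_tail_char; [exact: mulr_gt0|exact: YS].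
Qed.
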